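(* There exists a constant $C>0$ such that, for all but finitely many pairs $(N,M)$ of positive integers, every projection system $\mathcal P$ in $\mathbb C^N$ with exactly $M$ elements satisfies $$\mathrm{QDisc}(\mathcal P)\le C\sqrt{N+\log M}.$$ That is, $\mathrm{QDisc}(\mathcal P)=O(\sqrt{N+\log M})$, with implied constant independent of $N$, $M$ and $\mathcal P$.
   Context: $\mathcal M_N(\mathbb C)$ is the set of $N\times N$ complex matrices. A projection system in $\mathbb C^N$ is a finite set $\mathcal P$ of orthogonal projections of $\mathbb C^N$, i.e. matrices $P\in\mathcal M_N(\mathbb C)$ with $P^2=P=P^*$. A quantum coloring is a Hermitian matrix $\chi\in\mathcal M_N(\mathbb C)$ all of whose eigenvalues lie in $\{1,-1\}$. With $[A,B]=AB-BA$ and $\mathrm{tr}^2(X)=(\mathrm{tr}\,X)^2$, the quantum discrepancy of $\mathcal P$ is $$\mathrm{QDisc}(\mathcal P)=\min_{\chi\ \text{quantum coloring}}\ \max_{P\in\mathcal P}\left[\mathrm{tr}^2(\chi P)+\mathrm{tr}(\chi[\chi,P]P)\right]^{1/2}$$ (the expression in brackets is always real and non-negative). Convention for $O$: $f(m,n)=O(g(m,n))$ means that there is a constant $c>0$ independent of $m,n$ with $|f(m,n)|\le c|g(m,n)|$ for all but a finite set of pairs $(m,n)\in\mathbb N\times\mathbb N$. *)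

(* Defs.v *)
From HB Require Import structures.
From mathcomp Require Import all_boot all_order all_algebra finmap.
From mathcomp Require Import complex.
From mathcomp Require Import all_classical all_reals all_analysis.

Set Implicit Arguments.
Unset Strict Implicit.
Unset Printing Implicit Defensive.

Import Order.TTheory GRing.Theory Num.Theory.
Import numFieldNormedType.Exports.
Local Open Scope classical_set_scope.
Local Open Scope ring_scope.
Local Open Scope sesquilinear_scope.
Local Open Scope complex_scope.

Section QuantumDiscrepancy.
Context {R : realType} {N : nat}.
Implicit Types chi P : 'M[R[i]]_N.

Definition orthogonal_projection P : Prop := P *m P = P /\ P^t* = P.

Definition projection_system (PS : {fset 'M[R[i]]_N}) : Prop :=
  forall P, P \in PS -> orthogonal_projection P.

(* eigenvalue refers to row eigenvectors; the spectrum is the same as for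
   column vectors. *)
Definition quantum_coloring chi : Prop :=
  chi \is hermsymmx /\ forall a : R[i], eigenvalue chi a -> a = 1 \/ a = -1.

Definition commutator (A B : 'M[R[i]]_N) : 'M[R[i]]_N := A *m B - B *m A.

Definition discrepancy_form chi P : R[i] :=
  (\tr (chi *m P)) ^+ 2 + \tr (chi *m commutator chi P *m P).

(* For a coloring and a projection the form is a nonnegative real
   (discrepancy_form_ge0), so taking its real part loses nothing. *)
Definition discrepancy chi P : R := Num.sqrt (complex.Re (discrepancy_form chi P)).

(* The default 0 is harmless: every discrepancy is nonnegative. *)
Definition max_discrepancy (PS : {fset 'M[R[i]]_N}) chi : R :=
  \big[Num.max/0]_(P <- PS) discrepancy chi P.

(* The infimum is a minimum (QDisc_attained, QDisc_le). *)
Definition QDisc (PS : {fset 'M[R[i]]_N}) : R :=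
  inf [set max_discrepancy PS chi | chi in [set chi | quantum_coloring chi]].

Lemma quantum_coloringE chi :
  quantum_coloring chi <-> chi^t* = chi /\ chi *m chi = 1%:M.
Proof.
split=> [[herm eig]|[herm sq1]].
  have htr : chi^t* = chi.
    by move/is_hermitianmxP: herm; rewrite expr0 scale1r => <-.
  split=> //; have /hermitian_normalmx/orthomx_spectralP := herm.
  set P := spectralmx chi; set d := spectral_diag chi => E.
  have Pu : P \in unitmx by exact: spectral_unit.
  have PE : P *m chi = diag_mx d *m P.
    by rewrite [in LHS]E !mulmxA mulmxV // mul1mx.
  have dP i : d 0 i * d 0 i = 1.
    have : eigenvalue chi (d 0 i).
      apply/eigenvalueP; exists (row i P).
        by rewrite -row_mul PE; apply/rowP => j; rewrite mul_diag_mx !mxE.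
      apply: contraTneq Pu => r0; rewrite unitmxE (expand_det_row _ i) big1 ?unitr0 //.
      by move=> j _; have /rowP/(_ j) := r0; rewrite !mxE => ->; rewrite mul0r.
    by move=> /eig[] ->; rewrite ?mulrNN mulr1.
  rewrite E !mulmxA mulmxK // -[X in X *m P]mulmxA mulmx_diag.
  rewrite (_ : diag_mx _ = 1%:M) ?mulmx1 ?mulVmx //.
  rewrite -diag_const_mx; congr diag_mx; apply/rowP => i.
  by rewrite !mxE dP.
split.
  by apply/is_hermitianmxP; rewrite expr0 scale1r herm.
move=> a /eigenvalueP[v va v0].
have : (a ^+ 2 - 1) *: v = 0.
  rewrite scalerBl scale1r expr2 -scalerA -va scalemxAl -va -mulmxA sq1 mulmx1.
  by rewrite subrr.
move/eqP; rewrite scaler_eq0 (negbTE v0) orbF subr_sqr_1 mulf_eq0.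
by rewrite subr_eq0 addr_eq0 => /orP[]/eqP; [left|right].
Qed.

Lemma discrepancy_form_ge0 chi P :
  quantum_coloring chi -> orthogonal_projection P ->
  0 <= discrepancy_form chi P.
Proof.
move=> /quantum_coloringE[ch c2] [P2 Ph].
have trC (A : 'M[R[i]]_N) : \tr (A^t*) = (\tr A)^*%R.
  by rewrite -map_trmx mxtrace_tr trace_map_mx.
have adjM (A B : 'M[R[i]]_N) : (A *m B)^t* = B^t* *m A^t*.
  by rewrite trmx_mul map_mxM.
have tr_ge0 (A : 'M[R[i]]_N) : 0 <= \tr (A *m A^t*).
  apply: sumr_ge0 => i _; rewrite mxE; apply: sumr_ge0 => j _.
  by rewrite !mxE mul_conjC_ge0.
apply: addr_ge0.
  rewrite -realEsqr; apply/CrealP.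
  by rewrite -trC adjM ch Ph mxtrace_mulC.
have E : (commutator chi P)^t* = - commutator chi P.
  by rewrite /commutator linearB map_mxB /= !adjM ch Ph opprB.
have anti : commutator chi P *m chi = - (chi *m commutator chi P).
  by rewrite /commutator mulmxBl mulmxBr !mulmxA c2 mul1mx -(mulmxA P) c2 mulmx1 opprB.
have := tr_ge0 (commutator chi P).
have -> : \tr (commutator chi P *m (commutator chi P)^t*) =
   2%:R * \tr (chi *m commutator chi P *m P).
  rewrite E mulmxN {2}/commutator mulmxBr opprB raddfB /= !mulmxA anti mulNmx.
  by rewrite raddfN /= opprK [X in X + _]mxtrace_mulC mulmxA mulr_natl mulr2n.
by rewrite pmulr_rge0 // ltr0n.
Qed.

Lemma exists_quantum_coloring : exists chi, quantum_coloring chi.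
Proof.
exists 1%:M; apply/quantum_coloringE; split; last exact: mulmx1.
by rewrite trmx1 map_mx1.
Qed.

Lemma max_discrepancy_ge0 (PS : {fset 'M[R[i]]_N}) chi :
  0 <= max_discrepancy PS chi.
Proof. exact: bigmax_ge_id. Qed.

Lemma QDisc_le (PS : {fset 'M[R[i]]_N}) chi :
  quantum_coloring chi -> QDisc PS <= max_discrepancy PS chi.
Proof.
move=> cchi; apply: ge_inf; last by exists chi.
by exists 0 => _ [? _ <-]; exact: max_discrepancy_ge0.
Qed.

End QuantumDiscrepancy.

Section Attainment.
Context {R : realType} {N : nat}.
Let V := 'rV[R]_(N * N + N * N).

Let mxC (v : V) : 'M[R[i]]_N := \matrix_(i, j)
  (v 0 (lshift _ (mxvec_index i j)) +i* v 0 (rshift _ (mxvec_index i j))).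

Let mxC_surj chi : exists v, mxC v = chi.
Proof.
exists (row_mx (mxvec (map_mx (@complex.Re R) chi))
               (mxvec (map_mx (@complex.Im R) chi))).
apply/matrixP => i j; rewrite mxE row_mxEl row_mxEr !mxvecE !mxE.
by case: (chi i j).
Qed.

Let ccont (f : V -> R[i]) :=
  continuous (fun v => complex.Re (f v)) /\ continuous (fun v => complex.Im (f v)).

Let mcont (F : V -> 'M[R[i]]_N) := forall i j, ccont (fun v => F v i j).

Let ccont_cst c : ccont (fun=> c).
Proof. by split; exact: cst_continuous. Qed.

Let ccontD f g : ccont f -> ccont g -> ccont (fun v => f v + g v).
Proof.
move=> [f1 f2] [g1 g2]; split.
  have -> : (fun v => complex.Re (f v + g v)) =
    (fun v => complex.Re (f v) + complex.Re (g v)).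
    by apply/funext => v; rewrite raddfD.
  by move=> x; rewrite /continuous_at; exact: cvgD (f1 x) (g1 x).
have -> : (fun v => complex.Im (f v + g v)) =
  (fun v => complex.Im (f v) + complex.Im (g v)).
  by apply/funext => v; rewrite raddfD.
by move=> x; rewrite /continuous_at; exact: cvgD (f2 x) (g2 x).
Qed.

Let ccontM f g : ccont f -> ccont g -> ccont (fun v => f v * g v).
Proof.
move=> [f1 f2] [g1 g2]; split.
  have -> : (fun v => complex.Re (f v * g v)) = (fun v =>
     complex.Re (f v) * complex.Re (g v) - complex.Im (f v) * complex.Im (g v)).
    by apply/funext => v; case: (f v) (g v) => a b [].
  by move=> x; rewrite /continuous_at; exact: cvgB (cvgM (f1 x) (g1 x)) (cvgM (f2 x) (g2 x)).
have -> : (fun v => complex.Im (f v * g v)) = (fun v =>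
   complex.Re (f v) * complex.Im (g v) + complex.Im (f v) * complex.Re (g v)).
  by apply/funext => v; case: (f v) (g v) => a b [].
by move=> x; rewrite /continuous_at; exact: cvgD (cvgM (f1 x) (g2 x)) (cvgM (f2 x) (g1 x)).
Qed.

Let ccontJ f : ccont f -> ccont (fun v => (f v)^*%R).
Proof.
move=> [f1 f2]; split.
  have -> // : (fun v => complex.Re (f v)^*%R) = (fun v => complex.Re (f v)).
  by apply/funext => v; case: (f v).
have -> : (fun v => complex.Im (f v)^*%R) = (fun v => - complex.Im (f v)).
  by apply/funext => v; case: (f v).
by move=> x; rewrite /continuous_at; exact: cvgN (f2 x).
Qed.

Let ccont_sum (I : finType) (F : I -> V -> R[i]) :
  (forall i, ccont (F i)) -> ccont (fun v => \sum_i F i v).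
Proof.
move=> cF; elim: (index_enum I) => [|i s IH].
  by under eq_fun do rewrite big_nil; exact: ccont_cst.
by under eq_fun do rewrite big_cons; exact: ccontD.
Qed.

Let mcont_mxC : mcont mxC.
Proof.
move=> i j; split.
  by under eq_fun do rewrite mxE /=; exact: coord_continuous.
by under eq_fun do rewrite mxE /=; exact: coord_continuous.
Qed.

Let mcont_cst A : mcont (fun=> A).
Proof. by move=> i j; exact: ccont_cst. Qed.

Let mcontM F G : mcont F -> mcont G -> mcont (fun v => F v *m G v).
Proof.
move=> cF cG i j; under eq_fun do rewrite mxE.
by apply: ccont_sum => k; exact: ccontM.
Qed.

Let mcontB F G : mcont F -> mcont G -> mcont (fun v => F v - G v).
Proof.
move=> cF cG i j; under eq_fun do rewrite !mxE -mulN1r.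
by apply: ccontD => //; apply: ccontM => //; exact: ccont_cst.
Qed.

Let mcontJ F : mcont F -> mcont (fun v => (F v)^t*).
Proof. by move=> cF i j; under eq_fun do rewrite !mxE; exact: ccontJ. Qed.

Let ccont_tr F : mcont F -> ccont (fun v => \tr (F v)).
Proof. by move=> cF; apply: ccont_sum => i; exact: cF. Qed.

Let closed_mx0 F : mcont F -> closed [set v | F v = 0].
Proof.
move=> cF.
have -> : [set v | F v = 0] = \bigcap_(ij in [set: 'I_N * 'I_N])
   (((fun v => complex.Re (F v ij.1 ij.2)) @^-1` [set 0]) `&`
    ((fun v => complex.Im (F v ij.1 ij.2)) @^-1` [set 0])).
  apply/seteqP; split=> [v /= Fv [i j] _|v Fv]; first by rewrite /= Fv !mxE.
  apply/matrixP => i j; have [/= re im] := Fv (i, j) Logic.I.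
  by apply/eqP; rewrite eq_complex !mxE re im !eqxx.
apply: closed_bigI => -[i j] _; have [re im] := cF i j.
by apply: closedI; apply: preimage_closed => [x _|]; rewrite /=;
  [exact: re|exact: closed_eq|exact: im|exact: closed_eq].
Qed.

Let entry_le1 (chi : 'M[R[i]]_N) i j :
  quantum_coloring chi ->
  `|complex.Re (chi i j)| <= 1 /\ `|complex.Im (chi i j)| <= 1.
Proof.
move=> /quantum_coloringE[ch c2].
have : `|chi i j| ^+ 2 <= 1.
  have <- : \sum_k `|chi i k| ^+ 2 = 1.
    have : (chi *m chi^t*) i i = 1 by rewrite ch c2 mxE eqxx.
    by rewrite mxE => <-; apply: eq_bigr => k _; rewrite !mxE normCK.
  by rewrite (bigD1 j) //= lerDl; apply: sumr_ge0 => k _; exact: exprn_ge0.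
rewrite -add_Re2_Im2 lecE /= => /andP[_ le1].
split; rewrite -(ler_pXn2r (ltn0Sn 1)) ?nnegrE // expr1n real_normK ?num_real //;
 apply: le_trans le1; [rewrite lerDl|rewrite lerDr]; exact: sqr_ge0.
Qed.

Lemma QDisc_attained (PS : {fset 'M[R[i]]_N}) :
  exists2 chi, quantum_coloring chi & QDisc PS = max_discrepancy PS chi.
Proof.
pose A := [set v : V | quantum_coloring (mxC v)].
have A0 : A !=set0.
  have [chi cchi] := @exists_quantum_coloring R N.
  by have [v vE] := mxC_surj chi; exists v; rewrite /A /= vE.
have cA : compact A.
  have -> : A = [set v : V | forall k, (`[(-1)%R, 1%R]%classic : set R) (v 0 k)] `&`
      ([set v | (mxC v)^t* - mxC v = 0] `&` [set v | mxC v *m mxC v - 1%:M = 0]).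
    apply/seteqP; split=> v /=.
      move=> cv; have /quantum_coloringE[-> ->] := cv; rewrite !subrr.
      split=> // k; rewrite /= in_itv /= -ler_norml.
      by case: (split_ordP k) => m ->; case/mxvec_indexP: m => i j;
        have [] := entry_le1 i j cv; rewrite !mxE.
    by move=> [_ [/subr0_eq h1 /subr0_eq h2]]; apply/quantum_coloringE.
  apply: compact_closedI.
    apply: (@rV_compact R _ (fun=> `[(-1)%R, 1%R]%classic)) => k.
    exact: segment_compact.
  by apply: closedI; apply: closed_mx0; apply: mcontB;
    [exact: mcontJ|exact: mcont_mxC|exact: mcontM|exact: mcont_cst].
have cf : continuous (fun v => max_discrepancy PS (mxC v)).
  apply: continuous_big => [|P _]; first exact: max_continuous.
  have [re _] : ccont (fun v => discrepancy_form (mxC v) P).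
    have cP : mcont (fun=> P) by exact: mcont_cst.
    apply: ccontD.
      by apply: ccontM; apply: ccont_tr; exact: mcontM.
    apply: ccont_tr; apply: mcontM => //; apply: mcontM => //.
    by apply: mcontB; exact: mcontM.
  by move=> x; apply: continuous_comp; [exact: re|exact: sqrt_continuous].
have [v /set_mem Av vmin] := EVT_min_rV A0 cA (continuous_subspaceT cf).
exists (mxC v) => //; apply/eqP; rewrite eq_le QDisc_le //=.
apply: lb_le_inf; first by exists (max_discrepancy PS (mxC v)); exists (mxC v).
move=> _ [chi cchi <-]; have [w wE] := mxC_surj chi.
by rewrite -wE; apply: vmin; rewrite inE /A /= wE.
Qed.

End Attainment.

(* Main.v *)
(** Since [tr (chi [chi, P] P) = tr P - tr (chi P chi P) <= N], it is enough to
find a coloring with [|tr (chi P)| = O(sqrt (1 + log M))] for all [P].  Put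
[l = sqrt (1 + log M)] and let [chi] nearly minimize the energy
[\sum_P cosh (l tr (chi P))] among the colorings of trace 0 or 1.  In an
eigenbasis of [chi], rotating an eigenvector of eigenvalue 1 towards one of
eigenvalue -1, by a small angle of either sign, moves [tr (chi P)] by
[- c (P_jj - P_kk) +- 2 t Re P_jk], where [t ^+ 2 ~ 2 c].  Summed over all pairs
[(j, k)], the drifts add up to [- c N/2 tr (chi P)] (up to [O(c N)]), whereas
the variances add up to only [O(c N)], because the rows of [P] have norm at
most 1.  As no rotation lowers the energy noticeably, its second-order expansion
gives [\sum_P |tr (chi P)| cosh (l tr (chi P)) <= O(l) \sum_P cosh (l tr (chi P))],
which bounds every [tr (chi P)] by [O(l)]. *)

Require Import Defs.
From mathcomp Require Import all_boot all_order all_algebra finmap.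
From mathcomp Require Import complex.
From mathcomp Require Import all_classical all_reals all_analysis.
From mathcomp Require Import ring lra.

Set Implicit Arguments.
Unset Strict Implicit.
Unset Printing Implicit Defensive.

Import Order.TTheory GRing.Theory Num.Theory.
Local Open Scope classical_set_scope.
Local Open Scope ring_scope.
Local Open Scope sesquilinear_scope.
Local Open Scope complex_scope.

(** * Estimates for exponentials and hyperbolic functions *)

Definition cosh2 {R : realType} (x : R) : R := expR x + expR (- x).
Definition sinh2 {R : realType} (x : R) : R := expR x - expR (- x).

(** Since [1 - y <= expR (- y)], the exponential is at most [1 / (1 - y)], which the quadratic
    dominates as long as [1 - 2 * y] is nonnegative. *)
Lemma expR_le_quadratic {R : realType} (y : R) :
  y <= 2^-1 -> expR y <= 1 + y + 2 * y ^+ 2.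
Proof.
move=> y12; have y1 : 0 < 1 - y by lra.
have : expR y * (1 - y) <= 1.
  by rewrite -[leRHS](expRxMexpNx_1 y) ler_wpM2l ?expR_ge0 ?expR_ge1Dx.
rewrite -ler_pdivlMr // div1r => /le_trans; apply.
rewrite -[_^-1]div1r ler_pdivrMr //.
have -> : (1 + y + 2 * y ^+ 2) * (1 - y) = 1 + y ^+ 2 * (1 - 2 * y) by ring.
rewrite lerDl mulr_ge0 ?sqr_ge0 //; lra.
Qed.

Lemma cosh2_perturb {R : realType} (x y : R) : `|y| <= 2^-1 ->
  cosh2 (x + y) <= cosh2 x + y * sinh2 x + 2 * y ^+ 2 * cosh2 x.
Proof.
rewrite ler_norml => /andP[y1 y2].
have e1 := expR_le_quadratic y2.
have e2 : expR (- y) <= 1 - y + 2 * y ^+ 2.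
  by rewrite -[y ^+ 2]sqrrN expR_le_quadratic // lerNl.
rewrite /cosh2 /sinh2 opprD !expRD.
have p1 := expR_ge0 x; have p2 := expR_ge0 (- x).
nra.
Qed.

Lemma cosh2_ge2 {R : realType} (x : R) : 2 <= cosh2 x.
Proof.
have := expR_ge1Dx x; have := expR_ge1Dx (- x); rewrite /cosh2; lra.
Qed.

Lemma norm_sinh2_le {R : realType} (x : R) : `|sinh2 x| <= cosh2 x.
Proof.
have := expR_ge0 x; have := expR_ge0 (- x).
by rewrite /cosh2 /sinh2 => ? ?; rewrite ler_norml; apply/andP; split; lra.
Qed.

(** For [0 <= x] the two products differ by [2 * x * expR (- (l * x))], at most [2 / l <= 2] because
    [l * x <= expR (l * x)]; and [cosh2] is at least 2. Parity covers negative [x]. *)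
Lemma norm_mul_cosh2_le {R : realType} (l x : R) : 1 <= l ->
  `|x| * cosh2 (l * x) <= x * sinh2 (l * x) + l * cosh2 (l * x).
Proof.
move=> l1.
wlog x0 : x / 0 <= x.
  move=> H; have [/H//|x0] := leP 0 x.
  have := H (- x); rewrite normrN mulrN /cosh2 /sinh2 opprK => H'.
  have := H' ltac:(lra); lra.
rewrite ger0_norm // /cosh2 /sinh2.
have h : 2 * (x * expR (- (l * x))) <= 2.
  rewrite -[leRHS]mulr1 ler_pM2l //.
  have : l * x <= expR (l * x) by apply: le_trans (expR_ge1Dx _); lra.
  have := expR_gt0 (- (l * x)); have := expRxMexpNx_1 (l * x).
  set a := expR _; set b := expR _ => ab b0 la.
  have : l * x * b <= 1 by rewrite -ab ler_pM2r.
  have : 0 <= x * b by apply: mulr_ge0 => //; exact: ltW.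
  nra.
have := cosh2_ge2 (l * x); rewrite /cosh2.
set a := expR _; set b := expR _ in h * => ab.
nra.
Qed.

(* The function [(|x| - K) cosh2 (l x)] is bounded below, and large where
   [|x|] is. *)
Lemma norm_le_of_sum_cosh2 {R : realType} (I : eqType) (s : seq I) (f : I -> R)
    (l : R) (i : I) :
  1 <= l -> ln (size s)%:R + 1 <= l ^+ 2 -> i \in s ->
  \sum_(j <- s) `|f j| * cosh2 (l * f j) <=
    36 * l * \sum_(j <- s) cosh2 (l * f j) ->
  `|f i| <= 72 * l.
Proof.
move=> l1 lM si h; rewrite leNgt; apply/negP => fi.
have l0 : 0 < l by lra.
(* [B] offsets the negative summands: where [|f j| < K], [cosh2 (l * f j)] is at most
   [2 * expR (l * K)]. So each summand plus [B] is nonnegative, and a single one is bounded by their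
   total. *)
set K := 36 * l; set B := K * (2 * expR (l * K)).
have K0 : 0 < K by rewrite /K; lra.
have cle x : cosh2 (l * x) <= 2 * expR (l * `|x|).
  rewrite /cosh2 mulr_natl mulr2n; apply: lerD; rewrite ler_expR.
    by rewrite ler_pM2l // ler_norm.
  by rewrite -mulrN ler_pM2l // -normrN ler_norm.
have t0 j : 0 <= (`|f j| - K) * cosh2 (l * f j) + B.
  have c2 := cosh2_ge2 (l * f j).
  have [hK|hK] := leP K `|f j|.
    apply: addr_ge0; first by apply: mulr_ge0; lra.
    by rewrite /B; apply: mulr_ge0; [lra|apply: mulr_ge0 => //; exact: expR_ge0].
  have : cosh2 (l * f j) <= 2 * expR (l * K).
    by apply: (le_trans (cle _)); rewrite ler_pM2l // ler_expR ler_pM2l // ltW.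
  have := normr_ge0 (f j); rewrite /B.
  set c := cosh2 _; set e := 2 * _ => f0 ce.
  have : K * c <= K * e by rewrite ler_pM2l.
  have : 0 <= `|f j| * c by apply: mulr_ge0 => //; rewrite /c; lra.
  lra.
have tot : \sum_(j <- s) ((`|f j| - K) * cosh2 (l * f j) + B) <= (size s)%:R * B.
  rewrite big_split /= big_const_seq count_predT iter_addr_0.
  under eq_bigr do rewrite mulrBl.
  by rewrite sumrB -mulr_sumr mulr_natl gerDr subr_le0.
have one : (`|f i| - K) * cosh2 (l * f i) + B <= (size s)%:R * B.
  apply: le_trans tot; rewrite (big_rem i) //= lerDl.
  by apply: sumr_ge0 => j _; exact: t0.
have B0 : 0 < B by rewrite /B; apply: mulr_gt0 => //; apply: mulr_gt0 => //; exact: expR_gt0.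
have sz : (0 < size s)%N by case: (s) si.
(* The [+ 1] in the hypothesis on [l] pays for the factor 2 in [B], as [2 <= expR 1]. *)
have eM : 2 * (size s)%:R <= expR (l ^+ 2).
  apply: le_trans (_ : expR (1 + ln (size s)%:R) <= _); last first.
    by rewrite ler_expR addrC.
  rewrite expRD lnK ?posrE ?ltr0n // ler_wpM2r ?ler0n //.
  by apply: le_trans (expR_ge1Dx _).
(* As [|f i| > 72 * l = 2 * K], the factor [|f i| - K] exceeds [K]. The resulting bound
   [|f i| < l + K = 37 * l] is the contradiction. *)
have : K * expR (l * `|f i|) < K * expR (l ^+ 2 + l * K).
  rewrite expRD.
  have : expR (l * `|f i|) <= cosh2 (l * f i).
    rewrite /cosh2; have [f0|f0] := leP 0 (f i).
      by rewrite ger0_norm // lerDl expR_ge0.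
    by rewrite ltr0_norm // mulrN lerDr expR_ge0.
  have := expR_gt0 (l * `|f i|); have := expR_gt0 (l * K).
  move: one eM B0; rewrite /B.
  set c := cosh2 _; set e := expR (l * K); set g := expR (l * `|_|).
  set M := (size s)%:R; set q := expR (l ^+ 2) => one eM B0 e0 g0 gc.
  have k1 : K * g < (`|f i| - K) * c.
    apply: le_lt_trans (_ : K * c < _); first by rewrite ler_pM2l.
    by rewrite ltr_pM2r; [rewrite /K; lra|lra].
  have k2 : K * e * (2 * M) <= K * e * q by rewrite ler_pM2l ?mulr_gt0.
  lra.
rewrite ltr_pM2l // ltr_expR expr2 -mulrDr ltr_pM2l // /K => ?; lra.
Qed.

(** * Unitary conjugation and diagonalization of colorings *)

Lemma adjmxM {C : numClosedFieldType} {m n p : nat} (A : 'M[C]_(m, n)) (B : 'M[C]_(n, p)) :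
  (A *m B) ^t* = B ^t* *m A ^t*.
Proof. by rewrite trmx_mul map_mxM. Qed.

Lemma quantum_coloring_conj {R : realType} {n : nat} (V A : 'M[R[i]]_n) :
  V \is unitarymx -> quantum_coloring A -> quantum_coloring (V *m A *m V ^t*).
Proof.
move=> Vu /quantum_coloringE[Ah A2]; apply/quantum_coloringE; split.
  by rewrite !adjmxM trmxCK Ah mulmxA.
rewrite !mulmxA mulmxKtV // -[V *m A *m A]mulmxA A2 mulmx1.
exact/unitarymxP.
Qed.

Lemma orthogonal_projection_conj {R : realType} {n : nat} (V P : 'M[R[i]]_n) :
  V \is unitarymx -> orthogonal_projection P ->
  orthogonal_projection (V *m P *m V ^t*).
Proof.
move=> Vu [P2 Ph]; split; last by rewrite !adjmxM trmxCK Ph mulmxA.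
by rewrite !mulmxA mulmxKtV // -[V *m P *m P]mulmxA P2.
Qed.

Definition sign_mx {C : numClosedFieldType} {n : nat} (d : 'I_n -> bool) : 'M[C]_n :=
  diag_mx (\row_i (-1) ^+ d i).

Lemma sign_mx_coloring {R : realType} {n : nat} (d : 'I_n -> bool) :
  quantum_coloring (sign_mx d : 'M[R[i]]_n).
Proof.
apply/quantum_coloringE; split.
  rewrite tr_diag_mx map_diag_mx; congr diag_mx.
  by apply/rowP => i; rewrite !mxE rmorph_sign.
rewrite mulmx_diag -diag_const_mx; congr diag_mx; apply/rowP => i.
by rewrite !mxE -signr_addb addbb.
Qed.

(** The diagonal matrix given by the spectral theorem is a unitary conjugate of [chi], hence itself
    a coloring, so its entries square to 1. *)
Lemma quantum_coloring_diag {R : realType} {n : nat} (chi : 'M[R[i]]_n) :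
  quantum_coloring chi -> exists2 V : 'M[R[i]]_n, V \is unitarymx &
  exists d : 'I_n -> bool, chi = V *m sign_mx d *m V ^t*.
Proof.
move=> cchi; have [ch c2] := (quantum_coloringE _).1 cchi.
have /orthomx_spectralP E : chi \is normalmx.
  by apply/normalmxP; rewrite ch.
have Vu := spectral_unitarymx chi.
set P := spectralmx chi in E Vu; set D := spectral_diag chi in E.
exists (P ^t*); first by rewrite trmxC_unitary.
rewrite trmxCK; rewrite invmx_unitary // in E.
have DE : diag_mx D = P *m chi *m P ^t*.
  by rewrite [in RHS]E !mulmxA (unitarymxP Vu) mul1mx mulmxtVK.
have := quantum_coloring_conj Vu cchi; rewrite -DE.
move=> /quantum_coloringE[_ D2].
exists (fun i => D 0 i == -1); rewrite E; congr (_ *m _ *m _); congr diag_mx.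
apply/rowP => i; rewrite mxE.
move/matrixP: D2 => /(_ i i); rewrite mulmx_diag !mxE eqxx !mulr1n => /eqP.
by rewrite -expr2 sqrf_eq1; case: (D 0 i =P -1) => [->|_] //; rewrite orbF => /eqP.
Qed.

(** * Rotations in the plane of two eigenvectors *)

Lemma tr_delta_mul {C : comPzRingType} {n : nat} (j k : 'I_n) (A : 'M[C]_n) :
  \tr (delta_mx j k *m A) = A k j.
Proof.
rewrite /mxtrace (bigD1 j) //= big1 => [|i ij]; last first.
  by rewrite mxE big1 // => l _; rewrite mxE (negbTE ij) mul0r.
rewrite addr0 mxE (bigD1 k) //= big1 => [|l lk].
  by rewrite mxE !eqxx mul1r addr0.
by rewrite mxE (negbTE lk) andbF mul0r.
Qed.

Lemma diag_mul_delta {C : fieldType} {n : nat} (v : 'rV[C]_n) (j k : 'I_n) :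
  diag_mx v *m delta_mx j k = v 0 j *: delta_mx j k.
Proof.
apply/matrixP => a b; rewrite mul_diag_mx !mxE.
by case: eqP => [->|]; rewrite ?mulr0.
Qed.

Lemma delta_mul_diag {C : fieldType} {n : nat} (v : 'rV[C]_n) (j k : 'I_n) :
  delta_mx j k *m diag_mx v = v 0 k *: delta_mx j k.
Proof.
apply/matrixP => a b; rewrite mul_mx_diag !mxE mulrC.
by case: (b =P k) => [->|]; rewrite ?andbF ?mulr0.
Qed.

Lemma sqr_mxD {C : pzRingType} {n : nat} (A B : 'M[C]_n) :
  (A + B) *m (A + B) = A *m A + (A *m B + B *m A) + B *m B.
Proof. by rewrite mulmxDl !mulmxDr !addrA. Qed.

(** Two parameters [c] and [t] in place of an angle make every trace against this matrix affine in
    both. *)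
Definition sign_rotation {R : realType} {n : nat} (d : 'I_n -> bool)
    (j k : 'I_n) (c t : R) : 'M[R[i]]_n :=
  sign_mx d + ((- c)%:C *: (delta_mx j j - delta_mx k k) +
               t%:C *: (delta_mx j k + delta_mx k j)).

(* In the plane of the eigenvectors [j] (eigenvalue 1) and [k] (eigenvalue -1),
   [diag (1, -1)] is replaced by [[1 - c, t], [t, c - 1]]. *)
Lemma sign_rotation_coloring {R : realType} {n : nat} (d : 'I_n -> bool)
    (j k : 'I_n) (c t : R) :
  ~~ d j -> d k -> (1 - c) ^+ 2 + t ^+ 2 = 1 ->
  quantum_coloring (sign_rotation d j k c t).
Proof.
move=> dj dk ct; have [Dh D2] := (quantum_coloringE _).1 (@sign_mx_coloring R n d).
have jk : j != k by apply: contraNneq dj => ->.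
have kj : k != j by rewrite eq_sym.
have vj : (\row_i (-1) ^+ d i : 'rV[R[i]]_n) 0 j = 1 by rewrite mxE (negbTE dj).
have vk : (\row_i (-1) ^+ d i : 'rV[R[i]]_n) 0 k = -1 by rewrite mxE dk.
apply/quantum_coloringE; rewrite /sign_rotation.
set D := sign_mx d in Dh D2 *; set A := delta_mx j j - _; set B := delta_mx j k + _.
(* [E] projects onto the plane, where [D] and [A] act as the Pauli matrix Z and [B] as X. Hence the
   square of [D + x A + y B] is [1 + (2 x + x^2 + y^2) E], and with [x = - c], [y = t] the bracket
   vanishes by the circle equation. *)
pose E : 'M[R[i]]_n := delta_mx j j + delta_mx k k.
have DA : D *m A + A *m D = E + E.
  rewrite /A /D /sign_mx mulmxBr mulmxBl !diag_mul_delta !delta_mul_diag vj vk.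
  by rewrite !scale1r !scaleN1r !opprK.
have DB : D *m B + B *m D = 0.
  rewrite /B /D /sign_mx mulmxDr mulmxDl !diag_mul_delta !delta_mul_diag vj vk.
  by rewrite !scale1r !scaleN1r addrACA subrr addNr addr0.
have AA : A *m A = E.
  rewrite /A mulmxBr !mulmxBl !mul_delta_mx !mul_delta_mx_0 //.
  by rewrite subr0 sub0r opprK.
have BB : B *m B = E.
  rewrite /B mulmxDr !mulmxDl !mul_delta_mx !mul_delta_mx_0 //.
  by rewrite add0r addr0 addrC.
have AB : A *m B + B *m A = 0.
  rewrite /A /B mulmxBl mulmxBr !mulmxDl !mulmxDr !mul_delta_mx !mul_delta_mx_0 //.
  by rewrite !addr0 !add0r addrA subrK subrr.
have rJ (x : R) : (x%:C)^*%R = x%:C :> R[i].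
  by apply: CrealP; rewrite complex_real.
split.
  rewrite !(linearD, map_mxD) /= !(linearZ, map_mxZ) /= Dh !rJ.
  rewrite /A /B !(linearD, linearN, map_mxD, map_mxN) /=.
  by rewrite !trmx_delta !map_delta_mx [t%:C *: delta_mx k j + _]addrC.
set x := (- c)%:C; set y := t%:C.
have xy : x + x + x * x + y * y = 0.
  rewrite /x /y -!rmorphM -!rmorphD /=; apply/eqP; rewrite (_ : _ + _ = 0) //.
  by move: ct; rewrite !expr2 => ct; lra.
rewrite sqr_mxD sqr_mxD -!scalemxAl -!scalemxAr !scalerA AA BB D2.
have -> : D *m (x *: A + y *: B) + (x *: A + y *: B) *m D =
    x *: (D *m A + A *m D) + y *: (D *m B + B *m D).
  rewrite mulmxDl mulmxDr -!scalemxAl -!scalemxAr !scalerDr.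
  by rewrite addrACA.
rewrite DA DB [y * x]mulrC -[_ *: (A *m B) + _]scalerDr AB !scaler0 !addr0.
by rewrite scalerDr -!addrA -!scalerDl !addrA xy scale0r addr0.
Qed.

(** * Overlaps of colorings with projections, and entries of projections *)

(** The trace is already real for Hermitian arguments; the real part gives a real-valued function of
    all matrices. *)
Definition overlap {R : realType} {n : nat} (chi P : 'M[R[i]]_n) : R :=
  complex.Re (\tr (chi *m P)).

Lemma overlap_conj {R : realType} {n : nat} (V A P : 'M[R[i]]_n) :
  overlap (V *m A *m V ^t*) P = overlap A (V ^t* *m P *m V).
Proof. by rewrite /overlap -!mulmxA mxtrace_mulC -!mulmxA. Qed.

Lemma overlap_sign {R : realType} {n : nat} (d : 'I_n -> bool) (P : 'M[R[i]]_n) :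
  overlap (sign_mx d) P = \sum_i (-1) ^+ d i * complex.Re (P i i).
Proof.
rewrite /overlap /mxtrace raddf_sum; apply: eq_bigr => i _.
by rewrite mul_diag_mx !mxE; case: (d i); rewrite ?(mulN1r, mul1r) ?raddfN.
Qed.

(** This is the diagonal of the identity [P = P P^*]. *)
Lemma orthogonal_projection_diag {R : realType} {n : nat} (P : 'M[R[i]]_n) j :
  orthogonal_projection P ->
  complex.Re (P j j) =
    \sum_k (complex.Re (P j k) ^+ 2 + complex.Im (P j k) ^+ 2).
Proof.
move=> [P2 Ph]; rewrite -{1}P2 mxE raddf_sum; apply: eq_bigr => k _.
by rewrite -{2}Ph !mxE; case: (P j k) => a b /=; rewrite mulrN opprK !expr2.
Qed.

Lemma orthogonal_projection_Re_sym {R : realType} {n : nat} (P : 'M[R[i]]_n) j k :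
  orthogonal_projection P -> complex.Re (P k j) = complex.Re (P j k).
Proof. by move=> [_ Ph]; rewrite -{1}Ph !mxE; case: (P j k). Qed.

(** With diagonal entries at most 1, the squares of all [n^2] real parts add up to at most [n]; this
    keeps the total variance of the rotations small. *)
Lemma orthogonal_projection_row {R : realType} {n : nat} (P : 'M[R[i]]_n) j :
  orthogonal_projection P -> \sum_k complex.Re (P j k) ^+ 2 <= complex.Re (P j j).
Proof.
move=> Pp; rewrite (orthogonal_projection_diag j Pp); apply: ler_sum => k _.
by rewrite lerDl sqr_ge0.
Qed.

Lemma orthogonal_projection_Re_sqr {R : realType} {n : nat} (P : 'M[R[i]]_n) j k :
  orthogonal_projection P -> complex.Re (P j k) ^+ 2 <= complex.Re (P j j).
Proof.
move=> Pp; apply: le_trans (orthogonal_projection_row j Pp).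
by rewrite (bigD1 k) //= lerDl; apply: sumr_ge0 => i _; exact: sqr_ge0.
Qed.

Lemma orthogonal_projection_diag01 {R : realType} {n : nat} (P : 'M[R[i]]_n) j :
  orthogonal_projection P -> 0 <= complex.Re (P j j) <= 1.
Proof.
move=> Pp; have := orthogonal_projection_Re_sqr j j Pp.
by move: (complex.Re _) => r h; apply/andP; split; nra.
Qed.

Lemma overlap_sign_rotation {R : realType} {n : nat} (d : 'I_n -> bool) (j k : 'I_n)
    (c t : R) (P : 'M[R[i]]_n) : orthogonal_projection P ->
  overlap (sign_rotation d j k c t) P = overlap (sign_mx d) P
    - c * (complex.Re (P j j) - complex.Re (P k k)) + 2 * t * complex.Re (P j k).
Proof.
move=> Pp; rewrite /overlap /sign_rotation !mulmxDl -!scalemxAl mulmxBl mulmxDl.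
rewrite !mxtraceD !mxtraceZ mxtraceD [\tr (_ - _)]raddfB /= !tr_delta_mul.
rewrite raddfD /= -[RHS]addrA; congr (_ + _).
have := orthogonal_projection_Re_sym j k Pp.
case: (P j k) (P k j) (P j j) (P k k) => a b [a' b'] [r r'] [s s'] /= ->.
by ring.
Qed.

(** Rotations thus stay within the trace class over which the energy is minimized. *)
Lemma tr_sign_rotation {R : realType} {n : nat} (d : 'I_n -> bool) (j k : 'I_n)
    (c t : R) : j != k -> \tr (sign_rotation d j k c t) = \tr (sign_mx d : 'M[R[i]]_n).
Proof.
move=> jk; rewrite /sign_rotation !mxtraceD !mxtraceZ mxtraceD.
rewrite [\tr (_ - _)]raddfB /= -![delta_mx _ _ as X in \tr X]mulmx1 !tr_delta_mul.
by rewrite !mxE !eqxx eq_sym (negbTE jk) subrr addr0 !mulr0 !addr0.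
Qed.

(** With [q] plus signs and [p] minus signs, and [u], [v] the sums of [r] over them, both sides
    equal [p u - q v]. The first term on the right is the restoring drift, the second the error due
    to imbalance. *)
Lemma sum_sign_pairs {R : realType} {n : nat} (d : 'I_n -> bool) (r : 'I_n -> R) :
  \sum_(j | ~~ d j) \sum_(k | d k) (r j - r k) =
  n%:R / 2 * (\sum_i (-1) ^+ d i * r i) - (\sum_i (-1) ^+ d i) / 2 * \sum_i r i.
Proof.
have sgn (f : 'I_n -> R) : \sum_i (-1) ^+ d i * f i =
    \sum_(i | ~~ d i) f i - \sum_(i | d i) f i.
  rewrite (bigID d) /= addrC -sumrN; congr (_ + _); apply: eq_bigr => i.
    by move=> /negbTE ->; rewrite mul1r.
  by move=> ->; rewrite mulN1r.
have tot (f : 'I_n -> R) : \sum_i f i = \sum_(i | ~~ d i) f i + \sum_(i | d i) f i.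
  by rewrite (bigID d) /= addrC.
have -> : n%:R = \sum_(i < n) 1 :> R by rewrite sumr_const card_ord.
have -> : \sum_i (-1) ^+ d i = \sum_i (-1) ^+ d i * 1 :> R.
  by apply: eq_bigr => i _; rewrite mulr1.
rewrite !sgn !tot.
under eq_bigr do rewrite sumrB sumr_const -mulr_natr.
rewrite sumrB -mulr_suml !sumr_const.
rewrite -[X in _ - X = _]mulr_natr.
move: (\sum_(i | ~~ d i) r i) (\sum_(i | d i) r i) => u v.
set p := (#|d|)%:R; set q := (#|_|)%:R.
by field.
Qed.

(** * Change of the energy under rotations *)

(** Adding the second-order expansions for [t] and [- t] cancels all terms odd in [t]. The smallness
    conditions keep both shifts below 1/2, as [1/64 + 3/8 < 1/2]. *)
Lemma cosh2_rotation {R : realType} (l x a b c t : R) :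
  0 <= l -> 0 <= c -> t ^+ 2 <= 2 * c -> 64 * (l ^+ 2 * c) <= 1 -> 64 * (l * c) <= 1 ->
  `|a| <= 1 -> `|b| <= 1 ->
  cosh2 (l * (x - c * a + 2 * t * b)) + cosh2 (l * (x - c * a + 2 * (- t) * b)) <=
  2 * (cosh2 (l * x) - l * c * a * sinh2 (l * x) +
       2 * l ^+ 2 * (c ^+ 2 + 8 * c * b ^+ 2) * cosh2 (l * x)).
Proof.
move=> l0 c0 tc lc lc' a1 b1.
have small (t' : R) : t' ^+ 2 <= 2 * c -> `|l * (- (c * a) + 2 * t' * b)| <= 2^-1.
  move=> t'c; rewrite mulrDr; apply: le_trans (ler_normD _ _) _.
  have h1 : `|l * - (c * a)| <= 64^-1.
    rewrite mulrN normrN mulrA normrM (ger0_norm (mulr_ge0 l0 c0)).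
    have := normr_ge0 a; have := mulr_ge0 l0 c0; nra.
  (* Indeed [l^2 t'^2 <= 2 l^2 c <= 1/32 < (3/16)^2]. *)
  have lt1 : `|l * t'| <= 3 / 16.
    rewrite -(ler_pXn2r (ltn0Sn 1)) ?nnegrE ?normr_ge0 ?divr_ge0 //.
    rewrite real_normK ?num_real // exprMn.
    have : l ^+ 2 * t' ^+ 2 <= l ^+ 2 * (2 * c) by rewrite ler_wpM2l ?sqr_ge0.
    lra.
  have h2 : `|l * (2 * t' * b)| <= 3 / 8.
    have -> : l * (2 * t' * b) = 2 * ((l * t') * b) by ring.
    rewrite normrM (ger0_norm (ler0n _ 2)) normrM.
    have := normr_ge0 (l * t'); have := normr_ge0 b; nra.
  lra.
have s1 := small t tc; have s2 := small (- t); rewrite sqrrN in s2.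
have {s2} s2 := s2 tc.
have := cosh2_perturb (l * x) s1; have := cosh2_perturb (l * x) s2.
have shift u : l * (x - c * a + 2 * u * b) = l * x + l * (- (c * a) + 2 * u * b).
  by ring.
rewrite -!shift => e2 e1.
apply: le_trans (lerD e1 e2) _.
have c2 := cosh2_ge2 (l * x).
move: (cosh2 (l * x)) (sinh2 (l * x)) c2 e1 e2 => C S c2 _ _.
have a2 : a ^+ 2 <= 1 by rewrite -real_normK ?num_real // expr_le1.
have : 4 * l ^+ 2 * C * (c ^+ 2 * a ^+ 2 + 4 * t ^+ 2 * b ^+ 2) <=
   4 * l ^+ 2 * C * (c ^+ 2 * 1 + 4 * (2 * c) * b ^+ 2).
  apply: ler_wpM2l.
    by rewrite mulr_ge0 ?mulr_ge0 ?sqr_ge0 // (le_trans _ c2).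
  apply: lerD; first by rewrite ler_wpM2l ?sqr_ge0.
  by rewrite ler_wpM2r ?sqr_ge0 // ler_pM2l.
lra.
Qed.

Lemma orthogonal_projection_diagB {R : realType} {n : nat} (P : 'M[R[i]]_n) j k :
  orthogonal_projection P -> `|complex.Re (P j j) - complex.Re (P k k)| <= 1.
Proof.
move=> Pp; have /andP[] := orthogonal_projection_diag01 j Pp.
have /andP[] := orthogonal_projection_diag01 k Pp.
move: (complex.Re _) (complex.Re _) => u v *; rewrite ler_norml.
by apply/andP; split; lra.
Qed.

Lemma orthogonal_projection_Re_le1 {R : realType} {n : nat} (P : 'M[R[i]]_n) j k :
  orthogonal_projection P -> `|complex.Re (P j k)| <= 1.
Proof.
move=> Pp; have /andP[_ h1] := orthogonal_projection_diag01 j Pp.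
have := orthogonal_projection_Re_sqr j k Pp => /le_trans /(_ h1).
by rewrite -[_ ^+ 2]real_normK ?num_real // expr_le1.
Qed.

(* Lower bound for the average decrease of [cosh2 (l * overlap chi P)] when
   [chi = sign_mx d] is replaced by [sign_rotation d j k c t], over both signs
   of [t]. *)
Definition rotation_gain {R : realType} {n : nat} (d : 'I_n -> bool) (l c : R)
    (P : 'M[R[i]]_n) (j k : 'I_n) : R :=
  let x := overlap (sign_mx d) P in
  l * c * (complex.Re (P j j) - complex.Re (P k k)) * sinh2 (l * x) -
  2 * l ^+ 2 * (c ^+ 2 + 8 * c * complex.Re (P j k) ^+ 2) * cosh2 (l * x).

Lemma cosh2_sign_rotation {R : realType} {n : nat} (d : 'I_n -> bool) (j k : 'I_n)
    (l c t : R) (P : 'M[R[i]]_n) :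
  0 <= l -> 0 <= c -> t ^+ 2 <= 2 * c -> 64 * (l ^+ 2 * c) <= 1 -> 64 * (l * c) <= 1 ->
  orthogonal_projection P ->
  cosh2 (l * overlap (sign_rotation d j k c t) P) +
    cosh2 (l * overlap (sign_rotation d j k c (- t)) P) <=
  2 * (cosh2 (l * overlap (sign_mx d) P) - rotation_gain d l c P j k).
Proof.
move=> l0 c0 tc lc lc' Pp.
have := cosh2_rotation (overlap (sign_mx d) P) l0 c0 tc lc lc'
  (orthogonal_projection_diagB j k Pp) (orthogonal_projection_Re_le1 j k Pp).
rewrite -(overlap_sign_rotation d j k c t Pp).
rewrite -(overlap_sign_rotation d j k c (- t) Pp).
by move=> /le_trans; apply; rewrite ler_pM2l // /rotation_gain /= opprB addrA addrAC.
Qed.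

(** The drift comes from [sum_sign_pairs], whose imbalance error is at most [n / 2] because the
    signs nearly cancel and the trace of [Q] is at most [n]. The second-order terms cost
    [2 * (8 + 1 / 64) <= 33 / 2]. *)
Lemma sum_rotation_gain {R : realType} {n : nat} (d : 'I_n -> bool) (Q : 'M[R[i]]_n)
    (l c : R) :
  orthogonal_projection Q -> 0 <= l -> 0 <= c -> 64 * (c * n%:R) <= 1 ->
  `|\sum_i (-1) ^+ d i : R| <= 1 ->
  let x := overlap (sign_mx d) Q in
  c * n%:R * (l / 2 * (x * sinh2 (l * x)) - l / 2 * cosh2 (l * x)
              - 33 / 2 * l ^+ 2 * cosh2 (l * x)) <=
  \sum_(j | ~~ d j) \sum_(k | d k) rotation_gain d l c Q j k.
Proof.
move=> Qp l0 c0 cn tau1; rewrite /rotation_gain /=; set x := overlap _ _.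
have SC := norm_sinh2_le (l * x).
move: (sinh2 _) (cosh2 _) SC => S C SC; set tau := \sum_i _ in tau1.
have C0 : 0 <= C := le_trans (normr_ge0 S) SC.
have -> : \sum_(j | ~~ d j) \sum_(k | d k)
    (l * c * (complex.Re (Q j j) - complex.Re (Q k k)) * S -
     2 * l ^+ 2 * (c ^+ 2 + 8 * c * complex.Re (Q j k) ^+ 2) * C) =
  l * c * S * (\sum_(j | ~~ d j) \sum_(k | d k)
    (complex.Re (Q j j) - complex.Re (Q k k))) -
  2 * l ^+ 2 * C * (\sum_(j | ~~ d j) \sum_(k | d k)
    (c ^+ 2 + 8 * c * complex.Re (Q j k) ^+ 2)).
  rewrite !mulr_sumr -sumrB; apply: eq_bigr => j _.
  by rewrite !mulr_sumr -sumrB; apply: eq_bigr => k _; ring.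
rewrite sum_sign_pairs -overlap_sign -/tau.
rewrite -/x; set T := \sum_i complex.Re (Q i i).
have cst (a : R) : \sum_(i < n) a = a * n%:R.
  by rewrite sumr_const card_ord mulr_natr.
have T0 : 0 <= T by apply: sumr_ge0 => i _; case/andP: (orthogonal_projection_diag01 i Qp).
have Tn : T <= n%:R.
  by rewrite -[leRHS]mul1r -cst; apply: ler_sum => i _; case/andP: (orthogonal_projection_diag01 i Qp).
(* The nonnegative terms may be summed over all pairs; the row bound then gives [c^2 n^2 + 8 c n],
   and [c n <= 1/64]. *)
have second : \sum_(j | ~~ d j) \sum_(k | d k)
    (c ^+ 2 + 8 * c * complex.Re (Q j k) ^+ 2) <= c * n%:R * (8 + 1 / 64).
  apply: le_trans (_ : \sum_j \sum_k (c ^+ 2 + 8 * c * complex.Re (Q j k) ^+ 2) <= _).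
    have t0 j k : 0 <= c ^+ 2 + 8 * c * complex.Re (Q j k) ^+ 2.
      apply: addr_ge0; first exact: sqr_ge0.
      by apply: mulr_ge0; [exact: mulr_ge0|exact: sqr_ge0].
    rewrite [leRHS](bigID d) /= [leRHS]addrC -[leLHS]addr0; apply: lerD.
      apply: ler_sum => j _; rewrite [leRHS](bigID d) /= lerDl.
      by apply: sumr_ge0 => k _; exact: t0.
    apply: sumr_ge0 => j _; apply: sumr_ge0 => k _. exact: t0.
  apply: le_trans (_ : \sum_(j < n) (c ^+ 2 * n%:R + 8 * c * complex.Re (Q j j)) <= _).
    apply: ler_sum => j _; rewrite big_split /= cst lerD2l.
    by rewrite -mulr_sumr ler_wpM2l ?orthogonal_projection_row // mulr_ge0.
  rewrite big_split /= cst -mulr_sumr -/T.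
  have : c * n%:R * (64 * (c * n%:R)) <= c * n%:R * 1 by rewrite ler_wpM2l ?mulr_ge0.
  have : c * T <= c * n%:R by rewrite ler_wpM2l.
  lra.
have tT : `|tau * T * S| <= n%:R * C.
  rewrite !normrM -[n%:R]mul1r (ger0_norm T0).
  by apply: ler_pM => //; [rewrite mulr_ge0|apply: ler_pM].
have {tT} : l * c * (tau * T * S) <= l * c * (n%:R * C).
  by rewrite ler_wpM2l ?mulr_ge0 // (le_trans (ler_norm _) tT).
have : l ^+ 2 * C * (\sum_(j | ~~ d j) \sum_(k | d k)
    (c ^+ 2 + 8 * c * complex.Re (Q j k) ^+ 2)) <= l ^+ 2 * C * (c * n%:R * (8 + 1 / 64)).
  by rewrite ler_wpM2l ?mulr_ge0 ?sqr_ge0.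
have : 0 <= l ^+ 2 * C * (c * n%:R) by rewrite !mulr_ge0 ?sqr_ge0.
move: (\sum_(j | _) _) => Y; lra.
Qed.

(** * Near-minimizers of the energy among balanced colorings *)

Lemma tr_alternating_sign_mx {C : numClosedFieldType} (n : nat) :
  \tr (sign_mx (fun i : 'I_n => odd i)) = (odd n)%:R :> C.
Proof.
rewrite mxtrace_diag; under eq_bigr do rewrite mxE.
elim: n => [|n IH]; first by rewrite big_ord0.
rewrite big_ord_recr /= IH; case: (odd n) => /=; first by rewrite subrr.
by rewrite add0r.
Qed.

(** The trace of a coloring is an integer of the parity of [n], so no smaller absolute value is
    possible. *)
Definition balanced_coloring {R : realType} {n : nat} (chi : 'M[R[i]]_n) : Prop :=
  quantum_coloring chi /\ \tr chi = (odd n)%:R.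

(** The infimum is approached by definition, so continuity of [f] never enters; the alternating
    signs provide a balanced coloring. *)
Lemma exists_near_minimizer {R : realType} {n : nat} (f : 'M[R[i]]_n -> R) (eps : R) :
  0 < eps -> (forall chi, 0 <= f chi) ->
  exists2 chi, balanced_coloring chi &
    forall chi', balanced_coloring chi' -> f chi <= f chi' + eps.
Proof.
move=> e0 f0; pose A := [set f chi | chi in [set chi | balanced_coloring chi]].
have lbA : has_lbound A by exists 0 => _ [chi _ <-].
have A0 : A !=set0.
  exists (f (sign_mx (fun i : 'I_n => odd i))); eexists; last by [].
  by split; [exact: sign_mx_coloring|exact: tr_alternating_sign_mx].
have [_ [chi bchi <-] hchi] := inf_adherent e0 (conj A0 lbA).
exists chi => // chi' bchi'; apply: (le_trans (ltW hchi)).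
by rewrite lerD2r; apply: ge_inf => //; exists chi'.
Qed.

(** The conclusion is the averaged bound that [norm_le_of_sum_cosh2] turns into a bound on each
    overlap. *)
Lemma exists_low_energy_coloring {R : realType} {n : nat} (s : seq 'M[R[i]]_n) (l : R) :
  (0 < n)%N -> s != [::] -> 1 <= l -> {in s, forall P, orthogonal_projection P} ->
  exists2 chi, quantum_coloring chi &
    \sum_(P <- s) `|overlap chi P| * cosh2 (l * overlap chi P) <=
      36 * l * \sum_(P <- s) cosh2 (l * overlap chi P).
Proof.
move=> n0 s0 l1 sp; have nR : 1 <= n%:R :> R by rewrite ler1n.
have l0 : 0 < l by lra.
have l2 : 1 <= l ^+ 2 by rewrite exprn_ege1.
(* As [l] and [n] are at least 1, this [c] meets all the smallness conditions on rotations at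
   once. *)
set c := (64 * (l ^+ 2 * n%:R))^-1.
have c0 : 0 < c by rewrite invr_gt0 !mulr_gt0 // ?exprn_gt0 // ltr0n.
have cE : 64 * (l ^+ 2 * n%:R) * c = 1.
  by rewrite -[64 * _]invrK -/c mulVf ?gt_eqF.
have lc2 : 64 * (l ^+ 2 * c) <= 1.
  have : 64 * (l ^+ 2 * c) * 1 <= 64 * (l ^+ 2 * c) * n%:R.
    by rewrite ler_wpM2l // !mulr_ge0 ?sqr_ge0 // ltW.
  lra.
have lc1 : 64 * (l * c) <= 1.
  have : l * c <= l ^+ 2 * c by rewrite ler_pM2r // expr2 ler_peMl // ltW.
  lra.
have cn : 64 * (c * n%:R) <= 1.
  have : 1 * (c * n%:R) <= l ^+ 2 * (c * n%:R).
    by rewrite ler_wpM2r // mulr_ge0 // ltW.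
  lra.
have c1 : c <= 1 by have : c * 1 <= c * n%:R by [rewrite ler_pM2l|]; lra.
(* Solves [(1 - c)^2 + t^2 = 1]. *)
set t := Num.sqrt (2 * c - c ^+ 2).
have tE : t ^+ 2 = 2 * c - c ^+ 2 by rewrite sqr_sqrtr // expr2; nra.
have tc : t ^+ 2 <= 2 * c by rewrite tE gerBl sqr_ge0.
clearbody t c.
pose f chi := \sum_(P <- s) cosh2 (l * overlap chi P).
have f0 chi : 0 <= f chi.
  by apply: sumr_ge0 => P _; exact: le_trans (cosh2_ge2 _).
(* Over at most [n^2] pairs a slack of [c / n] adds up to [c n], the common factor in
   [sum_rotation_gain]. *)
have e0 : 0 < c / n%:R by rewrite divr_gt0 // ltr0n.
have [chi [cchi trchi] mchi] := exists_near_minimizer e0 f0.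
exists chi => //; have [V Vu [d E]] := quantum_coloring_diag cchi.
pose Q P := V ^t* *m P *m V.
have Qp P : P \in s -> orthogonal_projection (Q P).
  move=> /sp /(@orthogonal_projection_conj _ _ (V ^t*) P); rewrite trmxC_unitary trmxCK.
  exact.
have ovl P : overlap chi P = overlap (sign_mx d) (Q P) by rewrite E overlap_conj.
have trV (A : 'M[R[i]]_n) : \tr (V *m A *m V ^t*) = \tr A.
  by rewrite -mulmxA mxtrace_mulC mulmxKtV.
have tau1 : `|\sum_i (-1) ^+ d i : R| <= 1.
  have -> : \sum_i (-1) ^+ d i = (odd n)%:R :> R.
    apply: (@complexI R); rewrite rmorph_nat -trchi E trV mxtrace_diag rmorph_sum.
    by apply: eq_bigr => i _; rewrite mxE rmorph_sign.
  by case: (odd n); rewrite ?normr1 ?normr0.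
(* Both rotations, by [t] and by [- t], are balanced competitors of [chi]; averaging the two
   comparisons bounds the gain by the slack. *)
have pair j k : ~~ d j -> d k -> \sum_(P <- s) rotation_gain d l c (Q P) j k <= c / n%:R.
  move=> dj dk; have jk : j != k by apply: contraNneq dj => ->.
  pose rot u := V *m sign_rotation d j k c u *m V ^t*.
  have mrot u : u ^+ 2 = t ^+ 2 -> f chi <= f (rot u) + c / n%:R.
    move=> u2; apply: mchi; split.
      apply: (quantum_coloring_conj Vu (sign_rotation_coloring dj dk _)).
      by rewrite u2 tE; ring.
    by rewrite trV (tr_sign_rotation d c u jk) -trchi E trV.
  have : f (rot t) + f (rot (- t)) <=
      \sum_(P <- s) 2 * (cosh2 (l * overlap chi P) - rotation_gain d l c (Q P) j k).
    rewrite /f -big_split /= big_seq [leRHS]big_seq; apply: ler_sum => P Ps.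
    have e u : overlap (rot u) P = overlap (sign_rotation d j k c u) (Q P).
      exact: overlap_conj.
    have := cosh2_sign_rotation d j k (ltW l0) (ltW c0) tc lc2 lc1 (Qp P Ps).
    by rewrite -(e t) -(e (- t)) -ovl.
  rewrite -mulr_sumr sumrB -/(f chi).
  have half (a b b' g e : R) : a <= b + e -> a <= b' + e -> b + b' <= 2 * (a - g) -> g <= e.
    by move=> *; lra.
  exact: half (mrot t erefl) (mrot (- t) (sqrrN t)).
have total : \sum_(P <- s) \sum_(j | ~~ d j) \sum_(k | d k) rotation_gain d l c (Q P) j k
    <= c * n%:R.
  rewrite exchange_big /=.
  apply: le_trans (_ : \sum_(j | ~~ d j) \sum_(k | d k) c / n%:R <= _).
    apply: ler_sum => j dj; rewrite exchange_big /=.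
    by apply: ler_sum => k dk; exact: pair.
  rewrite !sumr_const -mulrnA -[leLHS]mulr_natr.
  have -> : c * n%:R = c / n%:R * (n * n)%:R.
    by rewrite natrM mulrA divfK // gt_eqF // ltr0n.
  rewrite ler_pM2l // ler_nat; apply: leq_mul;
    by rewrite -[leqRHS]card_ord max_card.
pose x P := overlap chi P; pose S P := sinh2 (l * x P); pose C P := cosh2 (l * x P).
have low : \sum_(P <- s) c * n%:R * (l / 2 * (x P * S P) - l / 2 * C P - 33 / 2 * l ^+ 2 * C P)
    <= c * n%:R.
  apply: le_trans total; rewrite big_seq [leRHS]big_seq; apply: ler_sum => P Ps.
  rewrite /S /C /x ovl.
  exact: (sum_rotation_gain (Qp P Ps) (ltW l0) (ltW c0) cn tau1).
have fC : f chi = \sum_(P <- s) C P by [].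
have f2 : 2 <= f chi.
  rewrite fC; case: (s) s0 => // P s' _; rewrite big_cons -[leLHS]addr0.
  apply: lerD; first exact: cosh2_ge2.
  by apply: sumr_ge0 => P' _; exact: le_trans (cosh2_ge2 _).
have {low} low : l / 2 * \sum_(P <- s) x P * S P <= 1 + (l / 2 + 33 / 2 * l ^+ 2) * f chi.
  move: low; rewrite -mulr_sumr -[leRHS]mulr1 ler_pM2l ?mulr_gt0 ?ltr0n //.
  by rewrite !sumrB -!mulr_sumr -fC => low; lra.
apply: le_trans (_ : \sum_(P <- s) (x P * S P + l * C P) <= _).
  by apply: ler_sum => P _; exact: norm_mul_cosh2_le.
rewrite big_split /= -mulr_sumr -fC -/(f chi).
(* After multiplication by [l], the terms [2], [l * f chi], [33 * l ^+ 2 * f chi] and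
   [l ^+ 2 * f chi] remain. With [2 <= f chi], they total at most [36 * l ^+ 2 * f chi]. *)
have h : l * (f chi) <= l ^+ 2 * f chi by rewrite ler_wpM2r // expr2 ler_peMl // ltW.
have h2 : 1 * f chi <= l ^+ 2 * f chi by rewrite ler_wpM2r.
rewrite -(ler_pM2l l0); lra.
Qed.

(** * From overlaps to the discrepancy *)

(** The trace of [chi P chi P] is the squared Frobenius norm of [P chi P], hence nonnegative, so the
    commutator term is at most the trace of [P]. *)
Lemma Re_discrepancy_form_le {R : realType} {n : nat} (chi P : 'M[R[i]]_n) :
  quantum_coloring chi -> orthogonal_projection P ->
  complex.Re (discrepancy_form chi P) <= overlap chi P ^+ 2 + n%:R.
Proof.
move=> /quantum_coloringE[ch c2] Pp; have [P2 Ph] := Pp.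
have -> : discrepancy_form chi P =
    \tr (chi *m P) ^+ 2 + (\tr P - \tr (chi *m P *m chi *m P)).
  rewrite /discrepancy_form /commutator mulmxBr mulmxBl raddfB /= !mulmxA c2.
  by rewrite mul1mx P2.
have pos : 0 <= \tr (chi *m P *m chi *m P).
  have -> : \tr (chi *m P *m chi *m P) =
      \tr ((P *m chi *m P) *m (P *m chi *m P) ^t*).
    rewrite !adjmxM ch Ph !mulmxA -[P *m chi *m P *m P]mulmxA P2.
    rewrite -[RHS]mxtrace_mulC.
    by rewrite !mulmxA P2 [in RHS]mxtrace_mulC !mulmxA.
  apply: sumr_ge0 => i _; rewrite mxE; apply: sumr_ge0 => j _.
  by rewrite !mxE mul_conjC_ge0.
have trP : complex.Re (\tr P) <= n%:R.
  have -> : n%:R = \sum_(i < n) 1 :> R by rewrite sumr_const card_ord.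
  rewrite raddf_sum; apply: ler_sum => i _.
  by case/andP: (orthogonal_projection_diag01 i Pp).
move: pos trP; rewrite lecE /overlap => /andP[_].
case: (\tr (chi *m P)) => a b; case: (\tr P) => u v.
case: (\tr (chi *m P *m chi *m P)) => z w /= z0 un.
(* The real part of [(a + i b)^2] is [a^2 - b^2], at most [a^2]. *)
have := sqr_ge0 b; rewrite !expr2; lra.
Qed.

Theorem theorem3 (R : realType) :
  exists2 C : R, 0 < C &
  exists2 E : set (nat * nat), finite_set E &
  forall N M : nat, (0 < N)%N -> (0 < M)%N -> ~ E (N, M) ->
  forall PS : {fset 'M[R[i]]_N}, projection_system PS -> #|` PS|%fset = M ->
  QDisc PS <= C * Num.sqrt (N%:R + ln M%:R).
Proof.
(* No pair is exceptional. For [1 <= N], [72^2 (1 + ln M) + N <= 73^2 (N + ln M)]. *)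
exists 73 => //; exists set0 => //.
move=> N M N0 M0 _ PS PSp cardPS.
have N1 : 1 <= N%:R :> R by rewrite ler1n.
have lnM : 0 <= ln M%:R :> R by rewrite ln_ge0 // ler1n.
pose l : R := Num.sqrt (1 + ln M%:R).
have l2 : l ^+ 2 = 1 + ln M%:R by rewrite sqr_sqrtr // addr_ge0.
have l1 : 1 <= l by rewrite -[leLHS]sqrtr1 ler_wsqrtr ?lerDl.
have PS0 : enum_fset PS != [::].
  by rewrite -size_eq0; apply: contraTneq M0; rewrite -cardPS => ->.
have [chi cchi hchi] := exists_low_energy_coloring N0 PS0 l1 PSp.
apply: (le_trans (QDisc_le _ cchi)).
(* The default 0 of the maximum has to lie below the bound as well. *)
rewrite /max_discrepancy big_seq; apply: bigmax_le => [|P PPS].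
  by rewrite mulr_ge0 ?sqrtr_ge0.
have ovl : `|overlap chi P| <= 72 * l.
  by apply: norm_le_of_sum_cosh2 hchi => //; rewrite cardPS l2 addrC.
have -> : 73 = Num.sqrt (73 ^+ 2) :> R by rewrite sqrtr_sqr ger0_norm.
rewrite -sqrtrM ?sqr_ge0 // ler_wsqrtr //.
apply: (le_trans (Re_discrepancy_form_le cchi (PSp P PPS))).
have : overlap chi P ^+ 2 <= (72 * l) ^+ 2.
  by rewrite -[overlap _ _ ^+ 2]real_normK ?num_real // lerXn2r ?nnegrE // mulr_ge0 // (le_trans _ l1).
rewrite exprMn l2; lra.
Qed.
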